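(* Let $X_n$ be the unitary Cayley graph of order $n$. Then the line graph $L(X_n)$ is strongly regular if and only if either $n$ is a prime greater than $3$ or $n$ is a power of $2$ greater than $2$.
   Context: The unitary Cayley graph $X_n$ is the graph with vertex set $\mathbb{Z}_n=\{0,1,\ldots,n-1\}$ in which $i$ and $j$ are adjacent if and only if $\gcd(i-j,n)=1$. The line graph $L(G)$ of a graph $G$ has the edges of $G$ as vertices, two being adjacent if the corresponding edges share a vertex. A strongly regular graph is a connected regular graph whose adjacency matrix has exactly three distinct eigenvalues. *)

(* Defs.v *)
From HB Require Import structures.
From mathcomp Require Import all_boot all_order all_algebra.
Set Implicit Arguments.
Unset Strict Implicit.
Unset Printing Implicit Defensive.
Import Order.TTheory GRing.Theory Num.Theory.

Record sgraph := SGraph {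
  vertex :> finType;
  adj : rel vertex;
  adj_sym : symmetric adj;
  adj_irrefl : irreflexive adj
}.

(* The clause i != j only matters for n = 1, where gcd(0, 1) = 1 would put a
   loop at the unique vertex. *)
Definition unitary_cayley_adj (n : nat) : rel 'I_n :=
  fun i j => (i != j) && (gcdz (i%:Z - j%:Z)%R n%:Z == 1%R).

Lemma unitary_cayley_adj_sym n : symmetric (@unitary_cayley_adj n).
Proof.
by move=> i j; rewrite /unitary_cayley_adj eq_sym -gcdNz opprB.
Qed.

Lemma unitary_cayley_adj_irrefl n : irreflexive (@unitary_cayley_adj n).
Proof. by move=> i; rewrite /unitary_cayley_adj eqxx. Qed.

Definition unitary_cayley (n : nat) : sgraph :=
  SGraph (@unitary_cayley_adj_sym n) (@unitary_cayley_adj_irrefl n).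

Definition edges (G : sgraph) : {set {set G}} :=
  [set A : {set G} | [exists x, exists y, adj x y && (A == [set x; y])]].

Definition edge (G : sgraph) : finType := {A : {set G} | A \in edges G}.

Definition line_adj (G : sgraph) : rel (edge G) :=
  fun a b => (a != b) && (val a :&: val b != set0).

Lemma line_adj_sym G : symmetric (@line_adj G).
Proof. by move=> a b; rewrite /line_adj eq_sym setIC. Qed.

Lemma line_adj_irrefl G : irreflexive (@line_adj G).
Proof. by move=> a; rewrite /line_adj eqxx. Qed.

Definition line_graph (G : sgraph) : sgraph :=
  SGraph (@line_adj_sym G) (@line_adj_irrefl G).

Definition connected (G : sgraph) : Prop :=
  forall x y : G, connect (@adj G) x y.

Definition regular (G : sgraph) : Prop :=
  exists d : nat, forall x : G, #|[set y | adj x y]| = d.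

Definition adjacency_matrix (C : numClosedFieldType) (G : sgraph) : 'M[C]_#|G| :=
  (\matrix_(i, j) (adj (enum_val i) (enum_val j))%:R)%R.

Definition num_eigenvalues (C : numClosedFieldType) (m : nat) (A : 'M[C]_m)
    (k : nat) : Prop :=
  exists s : seq C,
    [/\ uniq s, size s = k & forall a : C, eigenvalue A a = (a \in s)].

(* C ranges over algebraically closed fields such as algC or the complex
   numbers; adjacency matrices are integral and symmetric, so their spectra
   are real and do not depend on C. *)
Definition strongly_regular (C : numClosedFieldType) (G : sgraph) : Prop :=
  [/\ connected G, regular G & num_eigenvalues (adjacency_matrix C G) 3].

(* Main.v *)
Require Import Defs.
From HB Require Import structures.
From mathcomp Require Import all_boot all_order all_algebra.
From mathcomp Require Import ring zify.

(** Let [N] be the edge-vertex incidence matrix of an [r]-regular graph [G] with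
    adjacency matrix [A], and let [L] be the adjacency matrix of its line graph.
    Since [N N^T = L + 2] and [N^T N = A + r], the eigenvalues of [L] are the
    [a + r - 2], for [a != - r] an eigenvalue of [A], and possibly [-2].  In [X_n]
    the vertices are the elements of the ring Z/n and adjacency means that the
    difference is a unit.  For [n > 3] the eigenvalue [-2] does occur: for even [n]
    take alternating signs along the cycle [0, 1, ..., n - 1], for odd [n] take
    [1] on the edges of difference [+- 1] and [-1] on those of difference [+- 2].

    If [n] is prime then [X_n] is complete and if [n] is a power of [2] it is
    complete bipartite, which leaves exactly one eigenvalue of [X_n] besides
    [+- r].  Otherwise [n] has an odd prime factor [p], and there are two further
    eigenvalues: [- c], where [c] is the number of units in a nonzero residue
    class mod [p] (eigenvector [1_(x = 0 mod p) - 1_(x = 1 mod p)]), and either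
    [0] when [n] is a proper power of [p], or a positive number below [r] when
    there is another prime factor [q] (the product of the eigenvectors attached
    to [p] and [q]).  So [L] has at least four eigenvalues. *)

Set Implicit Arguments.
Unset Strict Implicit.
Unset Printing Implicit Defensive.
Import Order.TTheory GRing.Theory Num.Theory.
Local Open Scope ring_scope.

(** * Eigenvectors of a graph as functions on its vertices *)

Section EigenFunctions.
Variables (C : numClosedFieldType) (G : sgraph).

Definition nbr_sum (f : G -> C) (x : G) : C := \sum_(y | adj x y) f y.

Definition eigenfun (a : C) (f : G -> C) : Prop :=
  (exists x, f x != 0) /\ forall x, nbr_sum f x = a * f x.

Lemma eigenvalue_adjacencyP (a : C) :
  reflect (exists f, eigenfun a f) (eigenvalue (adjacency_matrix C G) a).
Proof.
have sum_enum (F : 'I_#|G| -> C) : \sum_i F i = \sum_x F (enum_rank x).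
  by rewrite (reindex enum_rank) //; apply: onW_bij; apply: enum_rank_bij.
apply: (iffP eigenvalueP) => [[v vA v0]|[f [[x0 fx0] fA]]].
  exists (fun x => v 0 (enum_rank x)); split.
    have [i vi] : exists i, v 0 i != 0.
      apply/existsP; apply: contraNT v0 => /existsPn v0.
      by apply/eqP/rowP => i; rewrite mxE; apply/eqP/negPn/v0.
    by exists (enum_val i); rewrite enum_valK.
  move=> x; move/rowP/(_ (enum_rank x)): vA; rewrite !mxE => <-.
  rewrite sum_enum /nbr_sum [LHS]big_mkcond; apply: eq_bigr => y _.
  by rewrite mxE !enum_rankK adj_sym; case: adj; rewrite ?mulr1 ?mulr0.
exists (\row_i f (enum_val i)); last first.
  apply: contraNneq fx0 => /rowP/(_ (enum_rank x0)).
  by rewrite !mxE enum_rankK => ->.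
apply/rowP => i; rewrite !mxE -fA /nbr_sum [RHS]big_mkcond sum_enum.
apply: eq_bigr => y _.
by rewrite !mxE !enum_rankK adj_sym; case: adj; rewrite ?mulr1 ?mulr0.
Qed.

(** Here [A + 1] is the all-ones matrix, so [(a + 1) * f x] is the total of [f] for every [x];
    unless [a = -1], [f] is constant. *)
Lemma complete_eigenvalue (a : C) :
  (forall x y : G, adj x y = (x != y)) ->
  eigenvalue (adjacency_matrix C G) a -> a = -1 \/ a = #|G|%:R - 1.
Proof.
move=> adjK /eigenvalue_adjacencyP[f [[x0 fx0] fA]].
have sumE x : \sum_y f y = (a + 1) * f x.
  rewrite (bigD1 x) //= mulrDl mul1r -fA addrC; congr (_ + _).
  by apply: eq_bigl => y; rewrite adjK eq_sym.
have [->|a1] := eqVneq a (-1); [by left | right].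
have {}a1 : a + 1 != 0 by rewrite addr_eq0.
have fc x : f x = f x0 by apply: (mulfI a1); rewrite -!sumE.
apply/eqP; rewrite eq_sym subr_eq; apply/eqP/(mulIf fx0).
by rewrite -sumE (eq_bigr _ (fun x _ => fc x)) sumr_const mulr_natl.
Qed.

End EigenFunctions.

(** * The incidence matrix and the spectrum of the line graph *)

Section Incidence.
Variables (C : numClosedFieldType) (G : sgraph).

(** [edge_sum] is the incidence matrix [N] and [star_sum] its transpose, as operators on
    functions. *)
Definition edge_sum (f : G -> C) (e : edge G) : C := \sum_(x in val e) f x.
Definition star_sum (F : edge G -> C) (x : G) : C :=
  \sum_(e : edge G | x \in val e) F e.

Lemma edgeP (e : edge G) : exists x y : G, adj x y /\ val e = [set x; y].
Proof.
case: e => A /= A_edge; move: (A_edge); rewrite inE.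
by case/existsP=> x /existsP[y /andP[xy /eqP->]]; exists x, y.
Qed.

Lemma adj_neq (x y : G) : adj x y -> x != y.
Proof. by apply: contraTneq => ->; rewrite adj_irrefl. Qed.

Lemma mem_edges (x y : G) : adj x y -> [set x; y] \in edges G.
Proof.
move=> xy; rewrite inE; apply/existsP; exists x; apply/existsP; exists y.
by rewrite xy eqxx.
Qed.

Definition edge_of (x y : G) (xy : adj x y) : edge G :=
  exist (fun A => A \in edges G) [set x; y] (mem_edges xy).

Lemma card_edge (e : edge G) : #|val e| = 2%N.
Proof. by have [x [y [xy ->]]] := edgeP e; rewrite cards2 adj_neq. Qed.

(** These are the entries of [N N^T = L + 2]: distinct edges share at most one vertex. *)
Lemma card_edgeI (e e' : edge G) :
  #|val e :&: val e'| = ((e == e').*2 + line_adj e e')%N.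
Proof.
rewrite /line_adj; have [->|ee'] /= := eqVneq e e'; first by rewrite setIid card_edge.
rewrite add0n -card_gt0; suff : (#|val e :&: val e'| < 2)%N by case: #|_| => [|[]].
rewrite ltnNge; apply: contraNN ee' => le2; apply/eqP/val_inj.
have sub1 : val e :&: val e' = val e.
  by apply/eqP; rewrite eqEcard subsetIl card_edge.
have sub2 : val e :&: val e' = val e'.
  by apply/eqP; rewrite eqEcard subsetIr card_edge.
by rewrite -[LHS]sub1 sub2.
Qed.

Lemma star_sumE (g : {set G} -> C) (x : G) :
  star_sum (fun e => g (val e)) x = \sum_(y | adj x y) g [set x; y].
Proof.
rewrite /star_sum -(big_sub_cond (mem (edges G)) (fun A : {set G} => x \in A)) /=.
rewrite -(big_imset (h := fun y => [set x; y]) (A := [pred y | adj x y])) /=.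
  apply: eq_bigl => A; apply/andP/imsetP => [[]|[y xy ->]]; last first.
    by rewrite mem_edges // !inE eqxx.
  rewrite inE => /existsP[u /existsP[v /andP[uv /eqP->]]].
  rewrite !inE => /orP[] /eqP->; [exists v => // | exists u].
    by rewrite inE adj_sym.
  by rewrite setUC.
move=> y z; rewrite !inE => xy xz /setP /(_ y).
by rewrite !inE eqxx orbT eq_sym (negPf (adj_neq xy)) => /esym/eqP.
Qed.

Lemma edge_star_sum (F : edge G -> C) (e : edge G) :
  edge_sum (star_sum F) e = 2 * F e + nbr_sum (G := line_graph G) F e.
Proof.
rewrite /edge_sum /star_sum (exchange_big_dep predT) //=.
transitivity (\sum_e' (((e == e').*2 + line_adj e e')%:R * F e')).
  apply: eq_bigr => e' _; rewrite sumr_const -card_edgeI mulr_natl; congr (_ *+ _).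
  by apply: eq_card => x; rewrite !inE.
under eq_bigr do rewrite natrD mulrDl.
rewrite big_split /=; congr (_ + _).
  rewrite (bigD1 e) //= eqxx big1 ?addr0 // => e' /negPf.
  by rewrite eq_sym => ->; rewrite mul0r.
rewrite /nbr_sum [RHS]big_mkcond; apply: eq_bigr => e' _ /=.
by case: line_adj; rewrite ?mul1r ?mul0r.
Qed.

Lemma star_edge_sum (f : G -> C) (x : G) :
  star_sum (edge_sum f) x = #|[set y | adj x y]|%:R * f x + nbr_sum f x.
Proof.
rewrite (star_sumE (fun A => \sum_(y in A) f y)).
under eq_bigr => y xy do rewrite big_setU1 ?inE ?adj_neq // big_set1.
rewrite big_split /= sumr_const mulr_natl; congr (_ *+ _ + _).
by apply: eq_card => y; rewrite !inE.
Qed.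

(** A nonzero [F] with [N^T F = 0] satisfies [L F = -2 F]. Symmetrizing [h] allows edge weights to
    be given along a direction. *)
Lemma line_eigenvalue_N2 (h : G -> G -> C) :
    (forall x, \sum_(y | adj x y) (h x y + h y x) = 0) ->
    (exists x y, adj x y /\ h x y + h y x != 0) ->
  eigenvalue (adjacency_matrix C (line_graph G)) (-2).
Proof.
move=> h0 [x0 [y0 [xy0 hxy0]]]; apply/eigenvalue_adjacencyP.
pose g (A : {set G}) := \sum_(x in A) \sum_(y in A | y != x) h x y.
have gE x y : x != y -> g [set x; y] = h x y + h y x.
  move=> xy; rewrite /g big_setU1 ?inE //= big_set1.
  congr (_ + _).
    rewrite (big_pred1 y) // => z; rewrite !inE.
    by have [->|] := eqVneq z x; rewrite ?andbT //= (negPf xy).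
  rewrite (big_pred1 x) // => z; rewrite !inE.
  by have [->|] := eqVneq z y; rewrite ?andbF ?orbF ?andbT // eq_sym (negPf xy).
exists (fun e : edge G => g (val e)); split.
  by exists (edge_of xy0); rewrite /= gE // adj_neq.
move=> e; have := edge_star_sum (fun e : edge G => g (val e)) e.
rewrite /edge_sum big1 => [/eqP|x _].
  by rewrite eq_sym addrC addr_eq0 mulNr => /eqP.
rewrite star_sumE -[RHS](h0 x); apply: eq_bigr => y xy.
by rewrite gE // adj_neq.
Qed.

Section Regular.
Variables (r : nat).
Hypothesis regG : forall x : G, #|[set y | adj x y]| = r.

(** The eigenvector is [N f], nonzero because [N^T N f = (a + r) f] and [a + r != 0]. *)
Lemma line_eigenvalue (a : C) : a != - r%:R ->
  eigenvalue (adjacency_matrix C G) a ->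
  eigenvalue (adjacency_matrix C (line_graph G)) (a + r%:R - 2).
Proof.
move=> ar /eigenvalue_adjacencyP[f [[x0 fx0] fA]]; apply/eigenvalue_adjacencyP.
have NNf x : star_sum (edge_sum f) x = (a + r%:R) * f x.
  by rewrite star_edge_sum regG fA; ring.
exists (edge_sum f); split=> [|e].
  apply/existsP; apply: contraNT fx0 => /existsPn Nf0.
  have /eqP := NNf x0; rewrite /star_sum big1 => [|e _]; last exact/eqP/negPn/Nf0.
  by rewrite eq_sym mulf_eq0 addr_eq0 (negPf ar).
have := edge_star_sum (edge_sum f) e.
rewrite {1}/edge_sum (eq_bigr _ (fun x _ => NNf x)) -mulr_sumr => eqN.
by apply/(addrI (2 * edge_sum f e)); rewrite -eqN /edge_sum; ring.
Qed.

(** If [N^T F] is nonzero, it is an eigenvector of [N^T N = A + r]; otherwise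
    [(a + 2) F = N N^T F = 0]. *)
Lemma line_eigenvalue_inv (a : C) :
  eigenvalue (adjacency_matrix C (line_graph G)) a ->
  a = -2 \/ eigenvalue (adjacency_matrix C G) (a + 2 - r%:R).
Proof.
case/eigenvalue_adjacencyP=> F [[e0 Fe0] FA].
have NNF e : edge_sum (star_sum F) e = (a + 2) * F e.
  by rewrite edge_star_sum FA; ring.
have [/existsP [x Fx]|/existsPn F0] := boolP [exists x, star_sum F x != 0].
  right; apply/eigenvalue_adjacencyP; exists (star_sum F); split; first by exists x.
  move=> y; have := star_edge_sum (star_sum F) y; rewrite regG.
  rewrite {1}/star_sum (eq_bigr _ (fun e _ => NNF e)) -mulr_sumr -/(star_sum F y) => eqN.
  by apply/(addrI (r%:R * star_sum F y)); rewrite -eqN; ring.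
left; apply/eqP; have /eqP := NNF e0.
rewrite /edge_sum big1 => [|x _]; last exact/eqP/negPn/F0.
by rewrite eq_sym mulf_eq0 (negPf Fe0) orbF addr_eq0.
Qed.

(** The degree is read off from [N N^T = L + 2] applied to the constant [1]. *)
Lemma regular_line_graph : regular (line_graph G).
Proof.
exists (r.*2 - 2)%N => e; have := edge_star_sum (fun=> 1) e.
have starE x : star_sum (fun=> 1) x = r%:R.
  rewrite (star_sumE (fun=> 1)) sumr_const -(regG x); congr (_ *+ _).
  by apply: eq_card => y; rewrite !inE.
rewrite /edge_sum (eq_bigr _ (fun x _ => starE x)) sumr_const card_edge.
rewrite /nbr_sum sumr_const mulr1 -mulrnA muln2 -natrD => /eqP.
rewrite eqr_nat => /eqP ->; rewrite addKn.
by apply: eq_card => e'; rewrite !inE.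
Qed.

End Regular.

(** The consecutive edges of a path between endpoints of [e] and [e'] lead from [e] to [e']. *)
Lemma connected_line_graph : connected G -> connected (line_graph G).
Proof.
move=> connG e e'.
have step (d d' : edge G) x : x \in val d -> x \in val d' ->
    connect (@adj (line_graph G)) d d'.
  move=> xd xd'; have [->|dd'] := eqVneq d d'; first exact: connect0.
  apply: connect1; rewrite /= /line_adj dd'; apply/set0Pn; exists x.
  by rewrite inE xd.
have [x xe] : exists x, x \in val e.
  by apply/card_gt0P; rewrite card_edge.
have [y ye'] : exists y, y \in val e'.
  by apply/card_gt0P; rewrite card_edge.
case/connectP: (connG x y) => p; elim: p x e xe => [|z p IHp] x e xe /=.
  by move=> _ yx; apply: step xe _; rewrite -yx.
case/andP=> xz zp yE.
pose d : edge G := edge_of xz.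
apply: connect_trans (step e d x xe _) (IHp z d _ zp yE);
  by rewrite /= !inE eqxx ?orbT.
Qed.

Lemma line_graph_complete : (#|G| <= 3)%N ->
  forall e e' : line_graph G, adj e e' = (e != e').
Proof.
move=> leG3 e e'; rewrite /= /line_adj; case: eqVneq => //= _.
rewrite -card_gt0; have := cardsUI (val e) (val e').
have : (#|val e :|: val e'| <= 3)%N := leq_trans (max_card _) leG3.
rewrite !card_edge; move: #|_ :|: _| #|_ :&: _| => u i; lia.
Qed.

End Incidence.

(** * The unitary Cayley graph in terms of the units of Z/n *)

Section UnitaryCayley.
Variables (C : numClosedFieldType) (m : nat).
Local Notation n := m.+2.
Local Notation X := (unitary_cayley m.+2).
Local Notation unit := (@GRing.unit 'I_m.+2).

Lemma ord_unitE (u : 'I_n) : (u \is a unit) = coprime n u.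
Proof. by []. Qed.

Lemma ord_natE k : nat_of_ord (k%:R : 'I_n) = (k %% n)%N.
Proof. exact: (@val_Zp_nat m.+2 isT k). Qed.

Lemma ord_addE d (x y : 'I_n) : (d %| n)%N -> (x + y)%R = (x + y)%N %[mod d].
Proof. exact: modn_dvdm. Qed.

(** Adding [y] back avoids truncated subtraction of representatives. *)
Lemma ord_subE d (x y : 'I_n) : (d %| n)%N -> ((x - y)%R + y)%N = x %[mod d].
Proof. by move=> dn; rewrite -ord_addE // subrK. Qed.

Lemma unitary_cayleyE (x y : 'I_n) : @adj X x y = (x - y \is a unit).
Proof.
rewrite /= /unitary_cayley_adj.
have [->|xy] /= := eqVneq x y; first by rewrite subrr unitr0.
rewrite ord_unitE coprime_sym.
suff -> : gcdz (x%:Z - y%:Z) n%:Z = gcdz (x - y : 'I_n)%R%:Z n%:Z by [].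
rewrite -gcdz_modl -[RHS]gcdz_modl; congr gcdz; apply/eqP.
rewrite -(eqz_modDr y) subrK -PoszD !modz_nat.
by rewrite ord_subE.
Qed.

Lemma nbr_sum_unit (F : 'I_n -> C) (x : 'I_n) :
  \sum_(y | @adj X x y) F y = \sum_(u : 'I_n | u \is a unit) F (x + u).
Proof.
rewrite (reindex_onto (fun u : 'I_n => x + u) (fun y => y - x)) /=; last first.
  by move=> y _; rewrite addrC subrK.
apply: eq_bigl => u; rewrite [X in X && _]unitary_cayleyE.
by rewrite opprD addNKr unitrN addrAC subrr add0r eqxx andbT.
Qed.

Definition deg_X : nat := #|[set u : 'I_n | u \is a unit]|.

Lemma regular_X (x : X) : #|[set y | adj x y]| = deg_X.
Proof.
rewrite /deg_X -[RHS](card_imset _ (@addrI _ (x : 'I_n))).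
apply: eq_card => y; rewrite inE unitary_cayleyE; apply/idP/imsetP => [xy|[u]].
  exists ((y : 'I_n) - x); first by rewrite inE -opprB unitrN.
  by rewrite addrC subrK.
by rewrite inE => u1 ->; rewrite opprD addNKr unitrN.
Qed.

Lemma connected_X : connected X.
Proof.
have conn0 k : connect (@adj X) 0 (k%:R : 'I_n).
  elim: k => [|k IHk]; first exact: connect0.
  apply: connect_trans IHk (connect1 _); rewrite unitary_cayleyE.
  by rewrite -natr1 opprD addNKr unitrN unitr1.
have {}conn0 (x : X) : connect (@adj X) 0 x.
  by rewrite -[x](@natr_Zp m x); apply: conn0.
move=> x y; apply: connect_trans (conn0 y).
by rewrite (sym_connect_sym (@adj_sym X)) conn0.
Qed.

Lemma eigenvalue_deg : eigenvalue (adjacency_matrix C X) deg_X%:R.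
Proof.
apply/eigenvalue_adjacencyP; exists (fun=> 1); split.
  by exists ord0; rewrite oner_eq0.
move=> x; rewrite /nbr_sum sumr_const mulr1 -(regular_X x).
by congr (_ *+ _); apply: eq_card => y; rewrite !inE.
Qed.

Lemma deg_X_gt1 : (0 < m)%N -> (1 < deg_X)%N.
Proof.
move=> m0; rewrite /deg_X (cardsD1 1) (cardsD1 (-1)) !inE unitrN unitr1 /=.
rewrite andbT add1n; case: eqP => // /(congr1 val) /=.
by rewrite !modn_small //; lia.
Qed.

(** With weight [s z] on the step from [z] to [z + w], only the steps out of [x] and into [x] count
    at [x]. *)
Lemma sum_shift (s : 'I_n -> C) (w x : 'I_n) : w \is a unit ->
  \sum_(y | @adj X x y) (s x * (y == x + w)%:R + s y * (x == y + w)%:R)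
  = s x + s (x - w).
Proof.
move=> wU; have delta (g : 'I_n -> C) z : @adj X x z ->
    \sum_(y : 'I_n | @adj X x y) g y * (y == z)%:R = g z.
  move=> xz; rewrite (bigD1 z) //= eqxx mulr1 big1 ?addr0 // => y.
  by case/andP=> _ /negPf->; rewrite mulr0.
rewrite big_split /= (delta (fun=> s x)); last first.
  by rewrite unitary_cayleyE opprD addNKr unitrN.
congr (_ + _); rewrite -[RHS]delta; last by rewrite unitary_cayleyE subKr.
by apply: eq_bigr => y _; rewrite [y == _]eq_sym subr_eq.
Qed.

(** The hypotheses together say [n > 3]; for [n = 3] the line graph is a triangle, with eigenvalues
    2 and -1 only. *)
Lemma line_X_eigenvalue_N2 : (0 < m)%N -> ~~ odd m || (2 < m)%N ->
  eigenvalue (adjacency_matrix C (line_graph X)) (-2).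
Proof.
move=> m0 m_even_or_large.
have adj01 : @adj X (0 : 'I_n) (1 : 'I_n).
  by rewrite unitary_cayleyE sub0r unitrN unitr1.
have [m_odd|m_even] := boolP (odd m).
  have m2 : (2 < m)%N by move: m_even_or_large; rewrite m_odd.
  pose h (x y : 'I_n) : C := (y == x + 1)%:R - (y == x + 2%:R)%:R.
  apply: (@line_eigenvalue_N2 C X h) => [x|]; last first.
    exists (0 : 'I_n), (1 : 'I_n); split=> //; rewrite /h !add0r eqxx.
    have neq (a b : nat) : (a < n)%N -> (b < n)%N -> a != b ->
        ((a%:R : 'I_n) == b%:R) = false.
      move=> an bn ab; apply/eqP => /(congr1 (@nat_of_ord _)).
      rewrite !ord_natE !modn_small //.
      exact/eqP.
    have -> : (1 == 2%:R :> 'I_n) = false by exact: (neq 1%N 2%N).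
    have -> : (0 == 1 + 1 :> 'I_n) = false by exact: (neq 0%N 2%N).
    have -> : (0 == 1 + 2%:R :> 'I_n) = false by exact: (neq 0%N 3%N _ (ltnW m2)).
    by rewrite !subr0 addr0 oner_eq0.
  have U2 : (2%:R : 'I_n) \is a unit.
    by rewrite ord_unitE ord_natE coprime_modr coprimen2 /= m_odd.
  (* The differences 1 and 2 contribute [1 + 1] each at every vertex, with opposite signs. *)
  have s1 := sum_shift (fun=> 1) x (unitr1 _).
  have /(congr2 (fun a b => a - b) s1) := sum_shift (fun=> 1) x U2.
  rewrite subrr -sumrB => s0; rewrite -[RHS]s0; apply: eq_bigr => y _.
  by rewrite /h !mul1r; ring.
pose h (x y : 'I_n) : C := (-1) ^+ x * (y == x + 1)%:R.
apply: (@line_eigenvalue_N2 C X h) => [x|]; last first.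
  exists (0 : 'I_n), (1 : 'I_n); split=> //; rewrite /h add0r eqxx expr0 mulr1.
  have -> : ((0 : 'I_n) == 1 + 1) = false.
    by apply/eqP => /(congr1 val); rewrite /= !modn_small.
  by rewrite mulr0 addr0 oner_eq0.
rewrite sum_shift ?unitr1 //.
(* As [n] is even, [x] and [x - 1] differ in parity even when [x = 0]. *)
have n2 : (2 %| n)%N by rewrite dvdn2 /= negbK.
have := ord_subE x 1 n2; rewrite !modn2 oddD.
rewrite -[(-1) ^+ x]signr_odd -[(-1) ^+ nat_of_ord (x - 1)]signr_odd.
by case: (odd x); case: odd => //= _; rewrite ?expr0 ?expr1 ?subrr ?addNr.
Qed.

(** * Units in a residue class modulo a divisor of [n] *)

Lemma unit_lift d a : (d %| n)%N -> coprime d a ->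
  exists2 w : 'I_n, w \is a unit & w = a %[mod d].
Proof.
move=> dn da; have d0 : (0 < d)%N by apply: dvdn_gt0 dn.
(* By the Chinese remainder theorem, [b] is taken congruent to [a] mod [d] and to 1 modulo the part
   of [n] prime to [d]. *)
set pi := \pi(d); have cop : coprime d n`_pi^'.
  by rewrite coprime_pi' // part_pnat.
set b := chinese d n`_pi^' a 1.
have bE : b %% n = b %[mod d] by apply: modn_dvdm.
exists (inZp b); last by rewrite /= bE chinese_modl.
rewrite ord_unitE /= coprime_modr -[X in coprime X](partnC pi) // coprimeMl.
apply/andP; split; last first.
  by rewrite coprime_sym -coprime_modl chinese_modr // coprime_modl coprime1n.
have db : coprime d b by rewrite -coprime_modr chinese_modl // coprime_modr.
(* [b = 0] forces [d = 1], and then the [pi]-part of [n] is 1. *)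
have [b_0|bgt0] := posnP b.
  move: db; rewrite b_0 /coprime !gcdn0 partn_eq1 // => /eqP d1.
  by apply/pnatP => // p _ _; rewrite /pi d1.
apply: (@pnat_coprime pi); first exact: part_pnat.
by rewrite -coprime_pi'.
Qed.

Definition residue_units d a : {set 'I_n} :=
  [set u : 'I_n | (u \is a unit) && (u == a %[mod d])].

(** Multiplication by a unit [w] congruent to [a] carries the class of 1 onto the class of [a]. *)
Lemma card_residue_units d a : (d %| n)%N ->
  #|residue_units d a| = if coprime d a then #|residue_units d 1| else 0%N.
Proof.
move=> dn; case: ifPn => [da|dNa]; last first.
  apply: eq_card0 => u; rewrite !inE ord_unitE; apply: contraNF dNa.
  case/andP=> nu /eqP ua; rewrite -coprime_modr -ua coprime_modr.
  exact: coprime_dvdl dn nu.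
have [w wU wa] := unit_lift dn da.
rewrite -[RHS](card_imset _ (mulrI wU)); apply: eq_card => u.
rewrite inE; apply/andP/imsetP => [[uU /eqP ua]|[z]]; last first.
  rewrite inE => /andP[zU /eqP z1] ->; rewrite unitrM wU zU /= modn_dvdm //.
  by rewrite -modnMm wa z1 modnMm muln1.
exists (w^-1 * u); last by rewrite mulVKr.
set z : 'I_n := w^-1 * u.
have zU : z \is a unit by rewrite unitrM unitrV wU.
rewrite inE zU andTb.
have {}ua : (a * z)%N = a * 1 %[mod d].
  rewrite -modnMml -wa modnMml muln1 -ua.
  have -> : u = w * z by rewrite mulVKr.
  by rewrite /= modn_dvdm.
(* Cancelling [a] goes through [d %| a * (z - 1)], so [z = 0] is treated apart. *)
move/eqP: ua; have [le1z|] := leqP 1 z.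
  by rewrite !eqn_mod_dvd ?leq_mul2l ?le1z ?orbT // -mulnBr Gauss_dvdr.
rewrite ltnS leqn0 => /eqP ->; rewrite eq_sym [0%N == _ %[mod d]]eq_sym.
by rewrite !eqn_mod_dvd ?leq_mul2l ?orbT // -mulnBr Gauss_dvdr.
Qed.

(** The sum counts the units congruent to [b - x] mod [d]; [n - x] stands for [- x]. *)
Lemma sum_residue d b (x : 'I_n) : (d %| n)%N ->
  \sum_(u : 'I_n | u \is a unit) ((x + u)%R == b %[mod d])%:R =
  (coprime d (b + (n - x)))%:R * #|residue_units d 1|%:R :> C.
Proof.
move=> dn; transitivity (#|residue_units d (b + (n - x))|%:R : C); last first.
  by rewrite card_residue_units //; case: coprime; rewrite ?mul1r ?mul0r.
rewrite -sum1_card natr_sum big_mkcond [RHS]big_mkcond; apply: eq_bigr => u _ /=.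
rewrite inE; case: (u \is a unit) => //=.
have -> : ((x + u)%R == b %[mod d]) = (u == b + (n - x) %[mod d]).
  rewrite ord_addE // -(eqn_modDr (n - x)) addnAC subnKC ?(ltnW (ltn_ord x)) //.
  by rewrite -modnDml (eqnP dn) add0n.
by case: eqP.
Qed.

Lemma coprime_residue p b (x : 'I_n) : prime p -> (p %| n)%N ->
  coprime p (b + (n - x)) = (x != b %[mod p]).
Proof.
move=> p_pr pn; have le_xn := ltnW (ltn_ord x).
rewrite prime_coprime // addnBA // -eqn_mod_dvd; last first.
  by apply: leq_trans le_xn (leq_addl _ _).
by rewrite -modnDmr (eqnP pn) addn0 eq_sym.
Qed.

Lemma residue_units_bounds d : (2 < d)%N -> (d %| n)%N ->
  (0 < #|residue_units d 1| < deg_X)%N.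
Proof.
move=> d2 dn; apply/andP; split.
  by apply/card_gt0P; exists 1; rewrite inE unitr1 /= eqxx.
apply: proper_card; apply/properP; split.
  by apply/subsetP => u; rewrite !inE => /andP[].
exists (-1); first by rewrite inE unitrN unitr1.
rewrite inE unitrN unitr1 /= -(eqn_modDr 1).
have := ord_subE 0 (1 : 'I_n) dn; rewrite sub0r.
rewrite [nat_of_ord 1]/= => ->.
by rewrite mod0n modn_small.
Qed.

(** * Eigenvalues of the unitary Cayley graph from prime factors of [n] *)

Lemma eigenvalue_prime p : prime p -> (2 < p)%N -> (p %| n)%N ->
  eigenvalue (adjacency_matrix C X) (- #|residue_units p 1|%:R).
Proof.
move=> p_pr p2 pn; apply/eigenvalue_adjacencyP.
exists (fun x : 'I_n => (x == 0 %[mod p])%:R - (x == 1 %[mod p])%:R); split.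
  exists (0 : 'I_n); rewrite /= eqxx mod0n modn_small ?prime_gt1 //.
  by rewrite subr0 oner_eq0.
(* The indicator of a class mod [p] has neighbour sum 0 on that class and [c] off it, so a
   difference of two such indicators is multiplied by [- c]. *)
move=> x; rewrite /nbr_sum nbr_sum_unit sumrB !sum_residue // !coprime_residue //.
by do 2!case: (_ == _) => /=; ring.
Qed.

Lemma eigenvalue_prime2 p q : prime p -> prime q -> p != q ->
    (p %| n)%N -> (q %| n)%N ->
  eigenvalue (adjacency_matrix C X) #|residue_units (p * q) 1|%:R.
Proof.
move=> p_pr q_pr pq pn qn.
have cpq : coprime p q by rewrite prime_coprime // dvdn_prime2.
have pqn : (p * q %| n)%N by rewrite Gauss_dvd // pn.
have sum2 b b' (x : 'I_n) :
    \sum_(u : 'I_n | u \is a unit)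
      ((x + u)%R == b %[mod p])%:R * ((x + u)%R == b' %[mod q])%:R
    = (x != b %[mod p])%:R * (x != b' %[mod q])%:R
      * #|residue_units (p * q) 1|%:R :> C.
  rewrite -natrM mulnb -!coprime_residue //.
  (* Both [b] and [b'] are replaced by their common Chinese lift, which merges the two conditions
     into coprimality to [p * q]. *)
  rewrite -coprime_modr -modnDml -[(b %% p)%N](chinese_modl cpq b b') modnDml coprime_modr.
  rewrite -[coprime q _]coprime_modr -modnDml -[(b' %% q)%N](chinese_modr cpq b b').
  rewrite modnDml coprime_modr.
  rewrite -coprimeMl -sum_residue //; apply: eq_bigr => u _.
  by rewrite -natrM mulnb chinese_remainder // chinese_modl // chinese_modr.
apply/eigenvalue_adjacencyP.
pose v (d : nat) (x : 'I_n) : C := (x == 0 %[mod d])%:R - (x == 1 %[mod d])%:R.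
exists (fun x : 'I_n => v p x * v q x); split.
  exists (0 : 'I_n); rewrite /v /= !eqxx !mod0n !modn_small ?prime_gt1 //.
  by rewrite subr0 mulr1 oner_eq0.
move=> x; rewrite /nbr_sum nbr_sum_unit /v.
under eq_bigr do rewrite mulrBl !mulrBr.
rewrite !sumrB !sum2.
by do 4!case: (_ == _) => /=; ring.
Qed.

Lemma eigenvalue0_of_twin (s t : 'I_n) : s != t ->
    (forall x : 'I_n, @adj X x s = @adj X x t) ->
  eigenvalue (adjacency_matrix C X) 0.
Proof.
move=> st twin; apply/eigenvalue_adjacencyP.
have delta (x z : 'I_n) : \sum_(y | @adj X x y) (y == z)%:R = (@adj X x z)%:R :> C.
  rewrite big_mkcond (bigD1 z) //= eqxx big1 ?addr0 => [|y /negPf->].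
    by case: unitary_cayley_adj.
  by case: ifP.
exists (fun y : 'I_n => (y == s)%:R - (y == t)%:R); split.
  by exists s; rewrite eqxx (negPf st) subr0 oner_eq0.
by move=> x; rewrite /nbr_sum sumrB !delta twin subrr mul0r.
Qed.

Lemma ord_unit_prime_power p k : prime p -> n = (p ^ k)%N ->
  forall u : 'I_n, (u \is a unit) = ~~ (p %| u)%N.
Proof.
move=> p_pr nE u; have k0 : (0 < k)%N by case: k nE.
by rewrite ord_unitE [X in coprime X]nE coprime_pexpl // prime_coprime.
Qed.

(** Adjacency depends only on the difference mod [p], so 0 and [p] have the same neighbours; the
    exponent makes them distinct vertices. *)
Lemma eigenvalue_prime_power p k : prime p -> n = (p ^ k.+2)%N ->
  eigenvalue (adjacency_matrix C X) 0.
Proof.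
move=> p_pr nE.
have ltpn : (p < n)%N by rewrite nE -[ltnLHS]expn1 ltn_exp2l // prime_gt1.
apply: (@eigenvalue0_of_twin 0 (Ordinal ltpn)) => [|x].
  by rewrite -val_eqE /= eq_sym -lt0n prime_gt0.
rewrite !unitary_cayleyE !(ord_unit_prime_power p_pr nE) subr0.
have pn : (p %| n)%N by rewrite nE expnS dvdn_mulr.
congr (~~ _); rewrite /dvdn -(ord_subE x (Ordinal ltpn) pn) /=.
by rewrite modnDr.
Qed.

End UnitaryCayley.

(** * From the spectrum of the Cayley graph to strong regularity of its line graph *)

Section LineGraphSpectrum.
Variables (C : numClosedFieldType) (m : nat).
Local Notation n := m.+2.
Local Notation X := (unitary_cayley m.+2).
Local Notation A := (adjacency_matrix C X).
Local Notation L := (adjacency_matrix C (line_graph X)).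
Local Notation r := ((deg_X m)%:R : C).

Lemma strongly_regular_of_spectrum (b : C) :
    (0 < m)%N -> ~~ odd m || (2 < m)%N -> b != r -> b != - r ->
    eigenvalue A b ->
    (forall a, eigenvalue A a -> [\/ a = r, a = - r | a = b]) ->
  strongly_regular C (line_graph X).
Proof.
move=> m0 m_odd br bNr Ab specA.
have r2 : r != - r.
  by rewrite -addr_eq0 -natrD pnatr_eq0 -lt0n addn_gt0 (ltnW (deg_X_gt1 m0)).
split; first exact/connected_line_graph/connected_X.
  exact: (regular_line_graph C (@regular_X m)).
pose shift a := a + r - 2; have shift_inj : injective shift by move=> x y /addIr/addIr.
have shiftNr : shift (- r) = -2 by rewrite /shift addNr add0r.
(* [- r] is listed because its shift is -2, an eigenvalue of [L] whether or not [- r] is one of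
   [A]. *)
exists (map shift [:: r; b; - r]); split=> //.
  by rewrite map_inj_uniq //= !inE !negb_or r2 bNr eq_sym br.
move=> a; have aE : a = shift (a + 2 - r) by rewrite /shift; ring.
apply/idP/idP => [La|].
  rewrite {1}aE mem_map // !inE.
  have [aN2|Aa] := line_eigenvalue_inv (@regular_X m) La.
    by rewrite aN2 addNr add0r eqxx !orbT.
  by case: (specA _ Aa) => ->; rewrite eqxx ?orbT.
rewrite /= !inE => /or3P[] /eqP ->.
- exact: (line_eigenvalue (@regular_X m) r2 (eigenvalue_deg C m)).
- exact: (line_eigenvalue (@regular_X m) bNr Ab).
- by rewrite shiftNr; apply: line_X_eigenvalue_N2.
Qed.

Lemma not_strongly_regular_of_spectrum (b c : C) :
    (0 < m)%N -> ~~ odd m || (2 < m)%N -> uniq [:: r; - r; b; c] ->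
    eigenvalue A b -> eigenvalue A c ->
  ~ strongly_regular C (line_graph X).
Proof.
move=> m0 m_odd u Ab Ac [_ _ [s [us size_s specL]]].
have [r2 bNr cNr] : [/\ r != - r, b != - r & c != - r].
  move: u; rewrite /= !inE !negb_or => /andP[/and3P[-> _ _]].
  by rewrite !(eq_sym (- r)) => /andP[/andP[-> ->]].
have inL a : a != - r -> eigenvalue A a -> a + r - 2 \in s.
  by move=> aNr Aa; rewrite -specL; apply: (line_eigenvalue (@regular_X m)).
have t_uniq : uniq (map (fun a => a + r - 2) [:: r; - r; b; c]).
  by rewrite map_inj_uniq // => x y /addIr/addIr.
have /(uniq_leq_size t_uniq) : {subset map (fun a => a + r - 2) [:: r; - r; b; c] <= s}.
  apply/allP; rewrite /= (inL r r2 (eigenvalue_deg C m)) (inL b) // (inL c) //=.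
  by rewrite andbT -specL addNr add0r line_X_eigenvalue_N2.
by rewrite size_s.
Qed.

Lemma strongly_regular_prime : prime n -> (3 < n)%N ->
  strongly_regular C (line_graph X).
Proof.
move=> n_pr n3; have m0 : (0 < m)%N := ltnW n3.
have n_odd : odd n by case: (even_prime n_pr) => // nE; lia.
have XK (x y : X) : adj x y = (x != y).
  rewrite unitary_cayleyE ord_unitE prime_coprime // -[in RHS](@subr_eq0 'I_n).
  rewrite -[in RHS]val_eqE; set z : 'I_n := _ - _; congr (~~ _).
  have [z0|z0] := posnP z; first by rewrite [val z]z0 dvdn0.
  by rewrite gtnNdvd // gtn_eqF.
(* [r] is an eigenvalue of a complete graph and differs from -1. *)
have degE : r = #|X|%:R - 1.
  have := eigenvalue_deg C m; case/(complete_eigenvalue XK) => // /eqP.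
  by rewrite -addr_eq0 natr1 pnatr_eq0.
apply: (@strongly_regular_of_spectrum (-1)) => //.
- by clear -n_odd n3; lia.
- by rewrite eq_sym -addr_eq0 natr1 pnatr_eq0.
- by rewrite (inj_eq oppr_inj) eq_sym pnatr_eq1 gtn_eqF // deg_X_gt1.
- apply/eigenvalue_adjacencyP.
  exists (fun x : 'I_n => (x == 0)%:R - (x == 1)%:R); split.
    exists (0 : 'I_n); have -> : (0 == 1 :> 'I_n) = false by rewrite eq_sym oner_eq0.
    by rewrite eqxx subr0 oner_eq0.
  move=> x; rewrite /nbr_sum.
  (* The values sum to 0, so those at the neighbours of [x] sum to minus the value at [x]. *)
  have sum0 : \sum_(y : X) ((y == 0 :> 'I_n)%:R - (y == 1 :> 'I_n)%:R) = 0 :> C.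
    have delta (z : 'I_n) : \sum_(y : 'I_n) (y == z)%:R = 1 :> C.
      by rewrite (bigD1 z) //= eqxx big1 ?addr0 // => y /negPf->.
    by rewrite sumrB !delta subrr.
  move: sum0; rewrite (bigD1 x) //= => /eqP; rewrite addrC addr_eq0 mulN1r => /eqP <-.
  by apply: eq_bigl => y; rewrite [LHS]XK eq_sym.
- move=> a /(complete_eigenvalue XK)[->|->]; first exact: Or33.
  by rewrite degE; apply: Or31.
Qed.

Lemma strongly_regular_pow2 k : n = (2 ^ k)%N -> (2 < n)%N ->
  strongly_regular C (line_graph X).
Proof.
move=> nE n2; have m0 : (0 < m)%N by [].
have n_even : (2 %| n)%N by rewrite nE; case: k nE => // k _; rewrite expnS dvdn_mulr.
have XE (x y : X) : adj x y = (odd (x : 'I_n) != odd (y : 'I_n)).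
  rewrite unitary_cayleyE (ord_unit_prime_power _ nE) //.
  have := ord_subE x y n_even; rewrite !modn2 oddD dvdn2 negbK.
  by do 3!case: odd.
pose cls (b : bool) (f : X -> C) := \sum_(x : X | odd (x : 'I_n) == b) f x.
have nbrE f (x : X) : nbr_sum f x = cls (~~ odd (x : 'I_n)) f.
  by apply: eq_bigl => y; rewrite XE; do 2!case: odd.
(* Each parity class is the neighbourhood of a vertex of the other class. *)
have card_cls b : (\sum_(x : X | odd (x : 'I_n) == b) 1 : C) = r.
  have [x xb] : exists x : 'I_n, odd x = ~~ b.
    by case: b; [exists 0 | exists 1].
  rewrite sumr_const -(@regular_X m x); congr (_ *+ _); apply: eq_card => y.
  by rewrite unfold_in inE XE xb; case: b {xb}; case: odd.
apply: (@strongly_regular_of_spectrum 0) => //.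
- by move: n_even; rewrite dvdn2 /= negbK => ->.
- by rewrite eq_sym pnatr_eq0 -lt0n (ltnW (deg_X_gt1 m0)).
- by rewrite eq_sym oppr_eq0 pnatr_eq0 -lt0n (ltnW (deg_X_gt1 m0)).
- case: k nE => [|[|k]] nE; [by [] | by case: nE n2 => -> |].
  exact: (@eigenvalue_prime_power C m 2 k).
move=> a /eigenvalue_adjacencyP[f [[x0 fx0] fA]].
have step b : a * cls b f = r * cls (~~ b) f.
  rewrite /cls mulr_sumr -(card_cls b) mulr_suml; apply: eq_bigr => x /eqP xb.
  by rewrite mul1r -fA nbrE xb.
have fE : a * f x0 = cls (~~ odd (x0 : 'I_n)) f by rewrite -fA nbrE.
(* If this class sum vanishes, then [a * f x0 = 0]; otherwise applying [step] twice gives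
   [a ^+ 2 = r ^+ 2]. *)
have [c0|cN0] := eqVneq (cls (~~ odd (x0 : 'I_n)) f) 0.
  apply: Or33; apply/eqP; move/eqP: fE.
  by rewrite c0 mulf_eq0 (negPf fx0) orbF.
have : (a - r) * (a + r) = 0.
  apply: (mulIf cN0); rewrite mul0r; set b := ~~ _.
  transitivity (a * (a * cls b f) - r * (r * cls b f)); first by ring.
  by have := step (~~ b); rewrite negbK (step b) => <-; ring.
move/eqP; rewrite mulf_eq0 subr_eq0 addr_eq0.
by case/orP=> /eqP ->; [apply: Or31 | apply: Or32].
Qed.

Lemma not_strongly_regular_composite : ~~ prime n ->
    ~ (exists k, n = (2 ^ k)%N) ->
  ~ strongly_regular C (line_graph X).
Proof.
move=> n_comp nN2.
have m0 : (0 < m)%N by move: n_comp; case: m.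
have m_large : ~~ odd m || (2 < m)%N 
  by move: n_comp; case: m => [|[|[|k]]] // _; rewrite orbT.
have [p [p_pr p2 pn]] : exists p, [/\ prime p, (2 < p)%N & (p %| n)%N].
  have [/p_natP[k nE]|] := boolP (2%N.-nat n); first by case: nN2; exists k.
  rewrite /pnat /= => /allPn[p]; rewrite mem_primes inE => /and3P[p_pr _ pn] pN2.
  by exists p; split=> //; rewrite ltn_neqAle eq_sym pN2 prime_gt1.
have /andP[c0 cr] := residue_units_bounds p2 pn.
have Ac := eigenvalue_prime C p_pr p2 pn.
(* As [0 < c < r], any eigenvalue [d] with [0 <= d < r] is distinct from [r], [- r] and [- c]. *)
have spectrum d : (d < deg_X m)%N -> eigenvalue A d%:R ->
    ~ strongly_regular C (line_graph X).
  move=> dr Ad; apply: (not_strongly_regular_of_spectrum m0 m_large _ Ac Ad).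
  have pos_neg (i j : nat) : (0 < i)%N -> (i%:R == - j%:R :> C) = false.
    by move=> i0; rewrite -addr_eq0 -natrD pnatr_eq0 addn_eq0 gtn_eqF.
  have neg_pos (i j : nat) : (0 < i)%N -> (- i%:R == j%:R :> C) = false.
    by move=> i0; rewrite eqr_oppLR pos_neg.
  rewrite /= !inE (inj_eq oppr_inj) !eqr_nat !pos_neg ?neg_pos //;
    rewrite ?(leq_trans c0 (ltnW cr)) //.
  by rewrite !gtn_eqF.
have [/p_natP[k nE]|] := boolP (p.-nat n).
  case: k nE => [|[|k]] nE; [by [] | by case/negP: n_comp; rewrite nE expn1 |].
  apply: (spectrum 0%N); first exact: leq_ltn_trans cr.
  exact: eigenvalue_prime_power nE.
rewrite /pnat /= => /allPn[q]; rewrite mem_primes inE => /and3P[q_pr _ qn] qNp.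
have pq : p != q by rewrite eq_sym.
have pqn : (p * q %| n)%N.
  by rewrite Gauss_dvd ?pn // prime_coprime // dvdn_prime2.
have /andP[d0 dr] : (0 < #|residue_units m (p * q) 1| < deg_X m)%N.
  apply: residue_units_bounds pqn; apply: leq_trans p2 _.
  by rewrite leq_pmulr // prime_gt0.
exact: spectrum dr (eigenvalue_prime2 C p_pr q_pr pq pn qn).
Qed.

End LineGraphSpectrum.

Local Close Scope ring_scope.

(** * Exclusion of [n <= 3] and the case distinction on [n] *)

Theorem theorem3p6 (C : numClosedFieldType) (n : nat) (hn : 0 < n) :
  strongly_regular C (line_graph (unitary_cayley n)) <->
  (prime n /\ 3 < n) \/ ((exists k : nat, n = 2 ^ k) /\ 2 < n).
Proof.
split=> [sr|].
  have n3 : 3 < n.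
    (* Edges of a graph on at most three vertices meet pairwise, so the line graph is complete and
       has at most two eigenvalues. *)
    rewrite ltnNge; apply/negP => le_n3.
    have cardX : #|unitary_cayley n| <= 3 by rewrite card_ord.
    case: sr => _ _ [s [us size_s specL]].
    have /(uniq_leq_size us) :
        {subset s <= [:: -1; #|line_graph (unitary_cayley n)|%:R - 1]%R}.
      move=> a; rewrite -specL !inE.
      case/(complete_eigenvalue (line_graph_complete cardX)) => ->;
        by rewrite eqxx ?orbT.
    by rewrite size_s.
  have [n_pr|n_comp] := boolP (prime n); first by left.
  right; split; last exact: ltnW.
  have [/p_natP[k nE]|n2] := boolP (2.-nat n); first by exists k.
  case: n hn n3 sr n_comp n2 => [|[|m]] // _ _ sr n_comp n2.
  case: (not_strongly_regular_composite n_comp _ sr) => -[k nE].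
  by move: n2; rewrite nE pnatX pnat_id.
case: n hn => [|[|m]] // _ [[n_pr n3]|[[k nE] n2]] //.
  exact: strongly_regular_prime.
exact: strongly_regular_pow2 nE n2.
Qed.
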